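(* Let $n\ge 1$, $M\ge 2$ be integers, let $\sigma>0$, and consider the linear regression model $Y=X\theta^*+W$, where $X$ is a deterministic $n\times M$ real matrix, $\theta^*\in\mathbb{R}^M$, and $W=(W_1,\dots,W_n)^T$ with $W_1,\dots,W_n$ i.i.d. $\mathcal{N}(0,\sigma^2)$. Let $\hat\Theta$ be either the set $\hat\Theta^L$ of all Lasso solutions or the set $\hat\Theta^D$ of all Dantzig solutions with tuning parameter $r=A\sigma\sqrt{(\log M)/n}$, where $A>2\sqrt{2}$; set $c_0=3$ if $\hat\Theta=\hat\Theta^L$ and $c_0=1$ if $\hat\Theta=\hat\Theta^D$. Assume that the Gram matrix $\Psi=\frac1n X^TX$ satisfies $\Psi_{j,j}=1$ for all $1\le j\le M$ and $$\max_{i\ne j}|\Psi_{i,j}|\le \frac{1}{\alpha(1+2c_0)s}$$ for some integer $s\ge 1$ and some constant $\alpha>1$, and that $M(\theta^* )\le s$. Let $$c_2=\frac32\left(1+\frac{(1+c_0)^2}{(1+2c_0)(\alpha-1)}\right),$$ and assume that there is a constant $c_1>2c_2$ such that $\min_{j\in J(\theta^* )}|\theta^*_j|>c_1 r$ (that is, $|\theta_j^*|>c_1r$ for every $j\in J(\theta^* )$). Let $\tilde\Theta$ be the set of all thresholded estimators $\tilde\theta$ associated with elements $\hat\theta\in\hat\Theta$ with threshold $c_2r$. Then $$\mathbb{P}\left(\overrightarrow{\mathrm{sign}}(\tilde\theta)=\overrightarrow{\mathrm{sign}}(\theta^* )\ \text{ for all }\tilde\theta\in\tilde\Theta\right)\ge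 1-M^{1-A^2/8}.$$
   Context: For $z\in\mathbb{R}^d$, $|z|_p=(\sum_j|z_j|^p)^{1/p}$ for $1\le p<\infty$ and $|z|_\infty=\max_j|z_j|$. For $\theta\in\mathbb{R}^M$, $J(\theta)=\{j:\theta_j\ne 0\}$ and $M(\theta)=|J(\theta)|$. For $r>0$, the Lasso solution set $\hat\Theta^L$ is the set of all minimizers over $\theta\in\mathbb{R}^M$ of $\frac1n|Y-X\theta|_2^2+2r|\theta|_1$. The Dantzig solution set $\hat\Theta^D$ is the set of all minimizers of $|\theta|_1$ over those $\theta\in\mathbb{R}^M$ satisfying $\left|\frac1n X^T(Y-X\theta)\right|_\infty\le r$. For $\hat\theta\in\hat\Theta$, the associated thresholded estimator $\tilde\theta\in\mathbb{R}^M$ with threshold $c_2r$ is defined by $\tilde\theta_j=\hat\theta_j$ if $|\hat\theta_j|>c_2r$ and $\tilde\theta_j=0$ otherwise. The sign vector is $\overrightarrow{\mathrm{sign}}(\theta)=(\mathrm{sign}(\theta_1),\dots,\mathrm{sign}(\theta_M))^T$, with $\mathrm{sign}(t)=1$ if $t>0$, $0$ if $t=0$, $-1$ if $t<0$. *)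

(* Defs.v *)
From HB Require Import structures.
From mathcomp Require Import all_boot all_order all_algebra.
From mathcomp Require Import all_classical all_reals all_analysis.

Set Implicit Arguments.
Unset Strict Implicit.
Unset Printing Implicit Defensive.

Import Order.TTheory GRing.Theory Num.Theory.
Import numFieldNormedType.Exports.

Local Open Scope classical_set_scope.
Local Open Scope ring_scope.

(* For p = +oo the library norm `|z| on matrices is the maximum of the
   absolute values of the entries, so |z|_oo is written `|z| below. *)
Definition lp_norm (R : realType) (d : nat) (p : R) (z : 'cV[R]_d) : R :=
  (\sum_(j < d) `|z j 0| `^ p) `^ p^-1.

Definition support_set (R : realType) (M : nat) (theta : 'cV[R]_M) : {set 'I_M} :=
  [set j | theta j 0 != 0]%SET.

Definition sparsity (R : realType) (M : nat) (theta : 'cV[R]_M) : nat :=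
  #|support_set theta|.

Definition gram (R : realType) (n M : nat) (X : 'M[R]_(n, M)) : 'M[R]_M :=
  n%:R^-1 *: (X^T *m X).

Definition minimizers (R : realType) (T : Type) (D : set T) (f : T -> R) : set T :=
  [set x | D x /\ forall y, D y -> f x <= f y].

Definition lasso_objective (R : realType) (n M : nat) (X : 'M[R]_(n, M))
    (r : R) (Y : 'cV[R]_n) (theta : 'cV[R]_M) : R :=
  n%:R^-1 * lp_norm 2 (Y - X *m theta) ^+ 2 + 2 * r * lp_norm 1 theta.

Definition lasso_set (R : realType) (n M : nat) (X : 'M[R]_(n, M))
    (r : R) (Y : 'cV[R]_n) : set 'cV[R]_M :=
  minimizers [set: 'cV[R]_M] (lasso_objective X r Y).

Definition dantzig_feasible (R : realType) (n M : nat) (X : 'M[R]_(n, M))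
    (r : R) (Y : 'cV[R]_n) : set 'cV[R]_M :=
  [set theta | `|n%:R^-1 *: (X^T *m (Y - X *m theta))| <= r].

Definition dantzig_set (R : realType) (n M : nat) (X : 'M[R]_(n, M))
    (r : R) (Y : 'cV[R]_n) : set 'cV[R]_M :=
  minimizers (dantzig_feasible X r Y) (fun theta => lp_norm 1 theta).

Inductive estimator := Lasso | Dantzig.

Definition solution_set (e : estimator) (R : realType) (n M : nat)
    (X : 'M[R]_(n, M)) (r : R) (Y : 'cV[R]_n) : set 'cV[R]_M :=
  match e with
  | Lasso => lasso_set X r Y
  | Dantzig => dantzig_set X r Y
  end.

Definition cone_constant (e : estimator) (R : realType) : R :=
  match e with
  | Lasso => 3
  | Dantzig => 1
  end.

Definition hard_threshold (R : realType) (M : nat) (c : R) (theta : 'cV[R]_M) :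
    'cV[R]_M :=
  \col_j (if c < `|theta j 0| then theta j 0 else 0).

Definition thresholded_set (e : estimator) (R : realType) (n M : nat)
    (X : 'M[R]_(n, M)) (r c : R) (Y : 'cV[R]_n) : set 'cV[R]_M :=
  hard_threshold c @` solution_set e X r Y.

Definition sign_vector (R : realType) (M : nat) (theta : 'cV[R]_M) : 'cV[R]_M :=
  map_mx Num.sg theta.

Definition mutually_independent (d : measure_display) (T : measurableType d)
    (R : realType) (P : probability T R) (I : finType) (W : I -> {RV P >-> R}) :
    Prop :=
  forall (J : {set I}) (B : I -> set R), (forall i, measurable (B i)) ->
    P (\bigcap_(i in [set` J]) (W i @^-1` B i)) =
    (\prod_(i in J) P (W i @^-1` B i))%E.

(* The laws are compared on measurable sets only: a measure carries no
   information on the value it takes at other sets. The second parameter of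
   normal_prob is the standard deviation. *)
Definition iid_normal (d : measure_display) (T : measurableType d)
    (R : realType) (P : probability T R) (I : finType) (m sigma : R)
    (W : I -> {RV P >-> R}) : Prop :=
  mutually_independent W /\
  forall (i : I) (B : set R), measurable B ->
    distribution P (W i) B = normal_prob m sigma B.

(* Main.v *)
(* On the event that every coordinate of X^T W / n is at most r / 2 in absolute
   value, any solution satisfies |Psi D|_oo <= 3 r / 2 for its error D, and D
   lies in the cone |D_{J^c}|_1 <= c0 |D_J|_1. Coherence then bounds |D_J|_1,
   hence |D|_oo <= c2 r, and thresholding at c2 r recovers the signs since the
   nonzero entries of theta^* exceed 2 c2 r.

   The noise coordinates are N(0, sigma^2 / n). The exact Gaussian law is
   needed (not only sub-Gaussianity): the two-sided tail P(|Z| > t) <=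
   exp(- t^2 / 2) carries no factor 2, contrary to the Chernoff bound. It
   follows by translating the two half-line integrals to the origin.

   The recovery event must also be shown measurable. The graph of the solution
   set is closed, so the observations admitting a solution in a given compact
   set form a closed set, and the solutions with a wrong sign vector form a
   countable union of compact boxes. For the Dantzig selector, closedness comes
   from perturbing feasible points towards a solution of the normal equation,
   which is strictly feasible. *)
Require Import Defs.
From HB Require Import structures.
From mathcomp Require Import all_boot all_order all_algebra.
From mathcomp Require Import all_classical all_reals all_analysis.
From mathcomp Require Import measurable_realfun.
From mathcomp Require Import ring lra.

Import Order.TTheory GRing.Theory Num.Theory.
Import numFieldNormedType.Exports.

Set Implicit Arguments.
Unset Strict Implicit.

Local Open Scope classical_set_scope.
Local Open Scope ring_scope.

(** * Deterministic error bounds *)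

Lemma lp_norm1E (R : realType) (d : nat) (z : 'cV[R]_d) :
  lp_norm 1 z = \sum_(j < d) `|z j 0|.
Proof.
rewrite /lp_norm invr1 (eq_bigr _ (fun j _ => powRr1 (normr_ge0 _))).
by rewrite powRr1// sumr_ge0.
Qed.

Lemma lp_norm2E (R : realType) (d : nat) (z : 'cV[R]_d) :
  lp_norm 2 z ^+ 2 = \sum_(j < d) z j 0 ^+ 2.
Proof.
rewrite /lp_norm -powR_mulrn ?powR_ge0// -powRrM mulVf// powRr1.
  by apply: eq_bigr => j _; rewrite powR_mulrn// real_normK ?num_real.
by rewrite sumr_ge0// => *; exact: powR_ge0.
Qed.

Lemma lasso_objectiveE (R : realType) (n M : nat) (X : 'M[R]_(n, M))
    (r : R) (Y : 'cV[R]_n) (theta : 'cV[R]_M) :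
  lasso_objective X r Y theta =
  n%:R^-1 * \sum_(i < n) (Y - X *m theta) i 0 ^+ 2
  + 2 * r * \sum_(j < M) `|theta j 0|.
Proof.
by congr (_ * _ + _ * _); [exact: lp_norm2E|exact: lp_norm1E].
Qed.

Lemma dantzig_feasibleP (R : realType) (n M : nat) (X : 'M[R]_(n, M))
    (r : R) (Y : 'cV[R]_n) (theta : 'cV[R]_M) : 0 <= r ->
  dantzig_feasible X r Y theta <->
  forall j, `|(n%:R^-1 *: (X^T *m (Y - X *m theta))) j 0| <= r.
Proof.
move=> r0; rewrite /dantzig_feasible/= [X in X <= _]/Num.norm/= mx_normrE.
split=> [/bigmax_leP[_ le_r] j|le_r]; first exact: (le_r (j, 0)).
by apply/bigmax_leP; split=> // -[i k] _ /=; rewrite ord1; exact: le_r.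
Qed.

(** The linear term is paired with [X^T u / n] because this correlation vector is what both the
    noise event and the optimality conditions control. *)
Lemma mean_square_expand (R : realType) (n M : nat) (X : 'M[R]_(n, M))
    (u : 'cV[R]_n) (D : 'cV[R]_M) :
  n%:R^-1 * \sum_(i < n) (u - X *m D) i 0 ^+ 2 =
  n%:R^-1 * \sum_(i < n) u i 0 ^+ 2
  - 2 * \sum_(j < M) (n%:R^-1 *: (X^T *m u)) j 0 * D j 0
  + n%:R^-1 * \sum_(i < n) (X *m D) i 0 ^+ 2.
Proof.
have -> : \sum_(j < M) (n%:R^-1 *: (X^T *m u)) j 0 * D j 0
    = n%:R^-1 * \sum_(i < n) u i 0 * (X *m D) i 0.
  rewrite mulr_sumr; under [RHS]eq_bigr do rewrite mxE mulr_sumr mulr_sumr.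
  rewrite exchange_big/=; apply: eq_bigr => j _.
  rewrite !mxE -mulrA mulr_suml mulr_sumr; apply: eq_bigr => i _.
  by rewrite mxE; ring.
rewrite mulrCA -mulrBr -mulrDr; congr (_ * _).
rewrite mulr_sumr -sumrB -big_split/=; apply: eq_bigr => i _.
by rewrite !mxE; ring.
Qed.

(** One half of the optimality conditions, obtained by moving a single coordinate by [t]; the unit
    diagonal makes the quadratic cost exactly [t ^+ 2]. In effect a Lasso solution is Dantzig
    feasible. *)
Lemma lasso_gradient_le (R : realType) (n M : nat) (X : 'M[R]_(n, M))
    (r : R) (Y : 'cV[R]_n) (theta : 'cV[R]_M) :
  0 <= r -> (forall j, gram X j j = 1) -> lasso_set X r Y theta ->
  forall j, `|(n%:R^-1 *: (X^T *m (Y - X *m theta))) j 0| <= r.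
Proof.
move=> r0 diag [_ opt] j; set g := _ j 0.
have key t : 2 * t * g <= t ^+ 2 + 2 * r * `|t|.
  pose D : 'cV[R]_M := t *: delta_mx j 0.
  have Dj : D j 0 = t by rewrite !mxE !eqxx/= mulr1.
  have Dk k : k != j -> D k 0 = 0 by move=> kj; rewrite !mxE (negbTE kj)/= mulr0.
  have := opt (theta + D) I.
  rewrite !lasso_objectiveE mulmxDr opprD addrA (mean_square_expand _ _ D).
  have -> : \sum_(k < M) (n%:R^-1 *: (X^T *m (Y - X *m theta))) k 0 * D k 0
      = t * g.
    rewrite (bigD1 j)//= big1 ?addr0 => [|k kj]; last by rewrite Dk// mulr0.
    by rewrite Dj mulrC.
  have -> : n%:R^-1 * \sum_(i < n) (X *m D) i 0 ^+ 2 = t ^+ 2.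
    transitivity (t ^+ 2 * gram X j j); last by rewrite diag mulr1.
    rewrite !mxE !mulr_sumr; apply: eq_bigr => i _.
    by rewrite -scalemxAr -colE !mxE; ring.
  have : \sum_(k < M) `|(theta + D) k 0| <= \sum_(k < M) `|theta k 0| + `|t|.
    rewrite (bigD1 j)//= [in leRHS](bigD1 j)//=.
    rewrite [X in _ + X <= _](eq_bigr (fun k => `|theta k 0|)); last first.
      by move=> k kj; rewrite mxE Dk// addr0.
    by rewrite [leRHS]addrAC lerD2r mxE Dj ler_normD.
  by nra.
rewrite leNgt; apply/negP => rg.
(* The soft-thresholded [g] maximizes [2 t g - t^2 - 2 r |t|]; the maximum [(|g| - r)^2] would be
   positive, against [key]. *)
have := key (Num.sg g * (`|g| - r)).
have sg2 : Num.sg g ^+ 2 = 1.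
  by rewrite sqr_sg; have [g0|//] := eqVneq g 0; move: rg; rewrite g0 normr0; lra.
have e1 : Num.sg g * g = `|g| by rewrite [in RHS]normrEsg.
rewrite normrM normr_sg exprMn sg2.
have -> : `| `|g| - r| = `|g| - r by rewrite ger0_norm//; lra.
have -> : (g != 0) = true by apply/eqP => g0; move: rg; rewrite g0 normr0; lra.
have -> : 2 * (Num.sg g * (`|g| - r)) * g = 2 * (`|g| - r) * `|g|.
  by rewrite -[X in _ = _ * X]e1; ring.
rewrite /=; nra.
Qed.

Section error_bounds.
Context (R : realType) (n M : nat) (X : 'M[R]_(n, M)).
Context (theta_star theta : 'cV[R]_M) (w : 'cV[R]_n) (r : R).
Hypothesis r0 : 0 < r.
Hypothesis noise : forall j, `|(n%:R^-1 *: (X^T *m w)) j 0| <= r / 2.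
Let J := support_set theta_star.
Let Y := X *m theta_star + w.
Let D := theta - theta_star.

(* The premise holds with [c = 1] for the Lasso, where [c] pays for the noise,
   and with [c = 0] for the Dantzig selector. *)
Lemma cone_of_l1_le (c : R) : 0 <= c ->
  \sum_j (`|theta j 0| - `|theta_star j 0|) * (1 + c)
    <= c * \sum_j `|D j 0| ->
  \sum_(j | j \notin J) `|D j 0|
    <= (1 + c *+ 2) * \sum_(j | j \in J) `|D j 0|.
Proof.
move=> c0; rewrite (bigID (mem J))/= [X in _ <= c * X](bigID (mem J))/=.
(* On [J] the triangle inequality loses at most [|D_j|]; off [J], where [theta_star] vanishes, the
   gain is exactly [|D_j|]. Hence [(1 + c) (|D_{J^c}|_1 - |D_J|_1) <= c |D|_1], which rearranges to
   the cone condition. *)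
have : - (1 + c) * \sum_(j | j \in J) `|D j 0| <=
    \sum_(j | j \in J) (`|theta j 0| - `|theta_star j 0|) * (1 + c).
  rewrite mulr_sumr; apply: ler_sum => j _; rewrite mulrC mulrN -mulNr.
  rewrite ler_wpM2r ?addr_ge0// lerNl opprB.
  have := ler_dist_dist (theta j 0) (theta_star j 0).
  by rewrite ler_norml /D !mxE => /andP[+ _]; lra.
have -> : \sum_(j | j \notin J) (`|theta j 0| - `|theta_star j 0|) * (1 + c)
    = (1 + c) * \sum_(j | j \notin J) `|D j 0|.
  rewrite mulr_sumr; apply: eq_bigr => j; rewrite inE negbK => /eqP s0.
  by rewrite !mxE s0 subr0 normr0 subr0 mulrC.
by rewrite mulr2n; nra.
Qed.

(** Minimality is tested against [theta_star]. For the Lasso, dropping the quadratic term leaves [2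
    r (|theta|_1 - |theta_star|_1) <= r |D|_1]. For the Dantzig selector, [theta_star] is feasible
    since its residual is the noise, so [|theta|_1 <= |theta_star|_1]. *)
Lemma solution_cone (e : estimator) : solution_set e X r Y theta ->
  \sum_(j | j \notin J) `|D j 0|
    <= cone_constant e R * \sum_(j | j \in J) `|D j 0|.
Proof.
have YE : Y - X *m theta_star = w by rewrite /Y addrAC subrr add0r.
case: e => /= [[_ /(_ theta_star I)]|[_ /(_ theta_star)]].
  rewrite !lasso_objectiveE.
  have -> : Y - X *m theta = w - X *m D.
    by rewrite /Y /D mulmxBr opprB addrCA addrA.
  rewrite YE (mean_square_expand _ _ D) => opt.
  have sq : 0 <= n%:R^-1 * \sum_(i < n) (X *m D) i 0 ^+ 2.
    by rewrite mulr_ge0// sumr_ge0// => i _; exact: sqr_ge0.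
  have cr : \sum_(j < M) (n%:R^-1 *: (X^T *m w)) j 0 * D j 0
      <= r / 2 * \sum_j `|D j 0|.
    rewrite mulr_sumr; apply: ler_sum => j _.
    by rewrite (le_trans (ler_norm _))// normrM ler_wpM2r.
  have -> : 3 = 1 + 1 *+ 2 :> R by ring.
  apply: cone_of_l1_le => //; rewrite -mulr_suml sumrB mul1r.
  by rewrite -(ler_pM2l r0); lra.
rewrite !lp_norm1E => opt; have -> : 1 = 1 + 0 *+ 2 :> R by ring.
apply: cone_of_l1_le => //.
rewrite mul0r addr0 -mulr_suml mulr1 sumrB subr_le0; apply: opt.
apply/dantzig_feasibleP; rewrite ?ltW// => j.
by rewrite YE (le_trans (noise j))// ler_pdivrMr// ler_peMr ?ler1n// ltW.
Qed.

(** [Psi D] is the noise correlation, at most [r / 2], minus the residual correlation, at most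
    [r]. *)
Lemma gram_error_le (e : estimator) : (forall j, gram X j j = 1) ->
  solution_set e X r Y theta ->
  forall j, `|(gram X *m D) j 0| <= 3 / 2 * r.
Proof.
move=> diag sol j.
have res : `|(n%:R^-1 *: (X^T *m (Y - X *m theta))) j 0| <= r.
  case: e sol => /= [|[+ _]]; first by move/lasso_gradient_le; apply => //; exact: ltW.
  by move/dantzig_feasibleP; apply; exact: ltW.
have -> : gram X *m D = n%:R^-1 *: (X^T *m w)
    - n%:R^-1 *: (X^T *m (Y - X *m theta)).
  have -> : Y - X *m theta = w - X *m D.
    by rewrite /Y /D mulmxBr opprB addrCA addrA.
  by rewrite (mulmxBr X^T) scalerBr subKr mulmxA /gram -scalemxAl.
rewrite mxE [X in _ + X]mxE; apply: (le_trans (ler_normB _ _)).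
have := noise j.
lra.
Qed.
End error_bounds.

(** With unit diagonal, [D_j] differs from [(Psi D)_j] by an off-diagonal sum of size at most
    [mu |D|_1], and the cone bounds [|D|_1] by [(1 + c0) a]. Summing over [J] bounds [a] in terms of
    itself with a factor below one; the resulting bound on [a] is then fed back into each
    coordinate. *)
Lemma sup_norm_of_coherence (R : realType) (M s : nat) (Psi : 'M[R]_M)
    (J : {set 'I_M}) (D : 'cV[R]_M) (alpha c0 b : R) :
  (1 <= s)%N -> (#|J| <= s)%N -> 1 < alpha -> 1 <= c0 -> 0 <= b ->
  (forall j, Psi j j = 1) ->
  (forall i j, i != j -> `|Psi i j| <= 1 / (alpha * (1 + 2 * c0) * s%:R)) ->
  (forall j, `|(Psi *m D) j 0| <= b) ->
  \sum_(j | j \notin J) `|D j 0| <= c0 * \sum_(j | j \in J) `|D j 0| ->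
  forall j,
  `|D j 0| <= b * (1 + (1 + c0) ^+ 2 / ((1 + 2 * c0) * (alpha - 1))).
Proof.
move=> s1 Js a1 c01 b0 diag; set mu := 1 / _ => coh PD cone.
have s0 : 0 < s%:R :> R by rewrite ltr0n.
have mu0 : 0 <= mu by rewrite /mu divr_ge0// !mulr_ge0//; lra.
pose a := \sum_(j | j \in J) `|D j 0|.
have a0 : 0 <= a by rewrite sumr_ge0.
have l1 : \sum_j `|D j 0| <= (1 + c0) * a.
  by rewrite (bigID (mem J))/= mulrDl mul1r lerD2l.
have key j : `|D j 0| <= b + mu * (1 + c0) * a.
  have -> : D j 0 = (Psi *m D) j 0 - \sum_(i | i != j) Psi j i * D i 0.
    by rewrite mxE (bigD1 j)//= diag mul1r addrK.
  apply: (le_trans (ler_normB _ _)); rewrite lerD//.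
  apply: (le_trans (ler_norm_sum _ _ _)); rewrite -mulrA.
  apply: (@le_trans _ _ (mu * \sum_j `|D j 0|)); last by rewrite ler_wpM2l.
  rewrite [in leRHS](bigD1 j)//= mulrDr.
  apply: ler_wpDl; first exact: mulr_ge0.
  rewrite mulr_sumr.
  by apply: ler_sum => i ij; rewrite normrM ler_wpM2r// coh// eq_sym.
have ale : a <= s%:R * b + s%:R * mu * (1 + c0) * a.
  rewrite (@le_trans _ _ (\sum_(j | j \in J) (b + mu * (1 + c0) * a)))//.
    by apply: ler_sum.
  rewrite sumr_const -[leLHS]mulr_natl.
  have -> : s%:R * b + s%:R * mu * (1 + c0) * a =
    s%:R * (b + mu * (1 + c0) * a) by ring.
  rewrite ler_wpM2r ?ler_nat//.
  by rewrite addr_ge0// (mulr_ge0 (mulr_ge0 mu0 _))//; lra.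
have smu : s%:R * mu = 1 / (alpha * (1 + 2 * c0)).
  by rewrite /mu; field; rewrite ?gt_eqF//; lra.
move=> j; rewrite (le_trans (key j))// [leRHS]mulrDr mulr1 lerD2l.
have k0 : 0 < alpha * (1 + 2 * c0) by nra.
have ale' : (alpha * (1 + 2 * c0) - (1 + c0)) * a <= alpha * (1 + 2 * c0) * s%:R * b.
  have : alpha * (1 + 2 * c0) * a <= alpha * (1 + 2 * c0) *
      (s%:R * b + s%:R * mu * (1 + c0) * a) by rewrite ler_pM2l.
  have -> : alpha * (1 + 2 * c0) * (s%:R * b + s%:R * mu * (1 + c0) * a) =
      alpha * (1 + 2 * c0) * s%:R * b + (1 + c0) * a.
    by rewrite smu; field; rewrite ?gt_eqF//; lra.
  by lra.
rewrite /mu; set q := (1 + c0) ^+ 2 / _.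
have -> : 1 / (alpha * (1 + 2 * c0) * s%:R) * (1 + c0) * a =
  (1 + c0) * a / (alpha * (1 + 2 * c0) * s%:R).
  by field; rewrite ?gt_eqF//; lra.
rewrite ler_pdivrMr ?mulr_gt0//; try lra.
(* The argument yields the left-hand factor. Its denominator exceeds [(1 + 2 c0) (alpha - 1)] by
   [c0] and its numerator is at most [(1 + c0) ^+ 2], so [q] dominates it. *)
have h : (1 + c0) / (alpha * (1 + 2 * c0) - (1 + c0)) <= q.
  rewrite /q ler_pdivrMr; last nra.
  rewrite mulrAC ler_pdivlMr; last nra.
  have : 0 <= (1 + c0) * (c0 * (alpha * (1 + 2 * c0) - c0)).
    by rewrite !mulr_ge0//; nra.
  by lra.
have k1 : 0 < alpha * (1 + 2 * c0) - (1 + c0) by nra.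
apply: (@le_trans _ _ (b * ((1 + c0) / (alpha * (1 + 2 * c0) - (1 + c0)))
   * (alpha * (1 + 2 * c0) * s%:R))); last first.
  by rewrite ler_wpM2r ?ler_wpM2l// !mulr_ge0//; lra.
have -> : b * ((1 + c0) / (alpha * (1 + 2 * c0) - (1 + c0)))
   * (alpha * (1 + 2 * c0) * s%:R) = (1 + c0) * (alpha * (1 + 2 * c0) * s%:R * b)
   / (alpha * (1 + 2 * c0) - (1 + c0)) by field; rewrite gt_eqF//.
rewrite ler_pdivlMr//.
have : 0 <= (1 + c0) * (alpha * (1 + 2 * c0) * s%:R * b -
    (alpha * (1 + 2 * c0) - (1 + c0)) * a) by rewrite mulr_ge0// ?subr_ge0//; lra.
by lra.
Qed.

(** Off the support the estimate is at most [c] and is cut to zero. On it, an error of at most [c]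
    against a value above [2 c] leaves a magnitude above [c] and cannot flip the sign. *)
Lemma sign_threshold_eq (R : realType) (M : nat) (theta theta_star : 'cV[R]_M)
    (c c' : R) : 0 <= c -> 2 * c <= c' ->
  (forall j, `|(theta - theta_star) j 0| <= c) ->
  (forall j, j \in support_set theta_star -> c' < `|theta_star j 0|) ->
  sign_vector (hard_threshold c theta) = sign_vector theta_star.
Proof.
move=> c0 cc' close large; apply/matrixP => j k; rewrite ord1 !mxE.
have := close j; have := large j; rewrite inE !mxE.
have [-> _|nz /(_ isT) lt_c] := eqVneq (theta_star j 0) 0.
  by rewrite subr0 ltNge => -> /=.
move=> cl; have -> : c < `|theta j 0|.
  have := ler_dist_dist (theta j 0) (theta_star j 0).
  by rewrite ler_norml => /andP[+ _]; lra.
move: cl lt_c; rewrite ler_norml => /andP[c1 c2].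
case: (ltrgtP (theta_star j 0) 0) nz => // [lt0|gt0] _.
  by rewrite ltr0_norm// => ?; rewrite !ltr0_sg//; lra.
by rewrite gtr0_norm// => ?; rewrite !gtr0_sg//; lra.
Qed.

(** * Measurability of the recovery event *)

(** If [v = u X^T] and [v X = 0] then [v v^T = 0], so [v = 0] by positivity of squares. Thus [X^T X]
    and [X] have the same rank, hence the same row space, which contains [Y^T X]. *)
Lemma normal_equation (R : realFieldType) (n M : nat) (X : 'M[R]_(n, M))
    (Y : 'cV[R]_n) : exists theta : 'cV[R]_M, X^T *m (Y - X *m theta) = 0.
Proof.
have ker0 : (X^T :&: kermx X)%MS == 0.
  rewrite -submx0; apply/rV_subP => v; rewrite sub_capmx => /andP[/submxP[u ->]].
  rewrite sub_kermx => /eqP uXX; rewrite submx0; apply/eqP.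
  have : (u *m X^T) *m (u *m X^T)^T = 0.
    by rewrite trmx_mul trmxK mulmxA uXX mul0mx.
  move=> /matrixP/(_ 0 0); rewrite [LHS]mxE [RHS]mxE => /eqP.
  rewrite psumr_eq0 => [/allP z|i _]; last by rewrite [X in _ * X]mxE -expr2 sqr_ge0.
  apply/matrixP => i j; rewrite ord1 [RHS]mxE.
  have := z j (mem_index_enum _); rewrite [X in _ * X]mxE -expr2 sqrf_eq0.
  by move/eqP.
have /mxrank_injP rk := ker0.
have sub : (X^T *m X <= X)%MS by exact: submxMl.
have XsX : (X <= X^T *m X)%MS.
  by have [_ <-] := mxrank_leqif_sup sub; rewrite rk mxrank_tr.
have /submxP[v vE] : (Y^T *m X <= X^T *m X)%MS.
  by apply: submx_trans XsX; exact: submxMl.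
exists v^T; apply: trmx_inj; rewrite trmx_mul trmxK trmx0 linearB/= trmx_mul trmxK.
by rewrite mulmxBl vE mulmxA subrr.
Qed.

(** The tube lemma: projecting a closed set along a compact factor gives a closed set. *)
Lemma open_no_witness (R : realType) (n M : nat) (K : set 'rV[R]_M) (G : set ('rV[R]_M * 'cV[R]_n)) :
  compact K -> open (~` G) ->
  open [set y | forall rho, K rho -> ~ G (rho, y)].
Proof.
move=> /compact_near_coveringP cK oG; rewrite openE => y Gy.
apply: (cK _ (nbhs y) (fun y' rho => ~ G (rho, y'))) => rho Krho.
have : nbhs (rho, y) (~` G) by apply: open_nbhs_nbhs; split => //; exact: Gy.
by apply: filterS => -[].
Qed.

(** An open set is a countable union of the cubes [B q] with rational centre and radius
    [1 / (k + 1)] that it contains, and each cube is a finite intersection of coordinate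
    conditions. *)
Lemma measurable_preimage_open (d : measure_display) (T : measurableType d)
    (R : realType) (n : nat) (f : T -> 'cV[R]_n) (U : set 'cV[R]_n) :
  (forall i, measurable_fun setT (fun x => f x i 0)) -> open U ->
  measurable (f @^-1` U).
Proof.
move=> mf oU.
pose Q := ('cV[rat]_n * nat)%type.
pose B (q : Q) : set 'cV[R]_n :=
  [set y | forall i, `|ratr (q.1 i 0) - y i 0| < q.2.+1%:R^-1].
have -> : f @^-1` U = \bigcup_(q : Q) (if `[< B q `<=` U >] then f @^-1` B q else set0).
  apply/seteqP; split=> [x Ufx|x [q _]]; last first.
    by case: asboolP => // + fx; apply.
  have [e e0 eU] : nbhs_ball (f x) U.
    by apply/nbhs_ballP; have := open_nbhs_nbhs (conj oU Ufx).
  (* Half of [e], since a point of the cube reaches [f x] through the rational centre, over two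
     radii. *)
  have e0' : 0 < e / 2 by rewrite divr_gt0.
  have [k] := ltr_add_invr e0'; rewrite add0r => ke.
  have rq i : exists q : rat, `|ratr q - f x i 0| < k.+1%:R^-1.
    have [|q] := @rat_in_itvoo R (f x i 0) (f x i 0 + k.+1%:R^-1).
      by rewrite ltrDl invr_gt0 ltr0n.
    rewrite in_itv/= => /andP[fq qf]; exists q.
    by rewrite gtr0_norm ?subr_gt0// ltrBlDl.
  have [g gP] := choice rq.
  exists (\col_i g i, k) => //.
  have BU : B (\col_i g i, k) `<=` U.
    move=> y By; apply: eU; rewrite mx_norm_ball /ball_/=.
    rewrite [ltLHS]/Num.norm/= mx_normrE; apply/bigmax_ltP; split => // -[i l] _.
    have := By i; have := gP i; rewrite /= !mxE ord1.
    move: (_^-1) ke => a ke.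
    rewrite !ltr_norml => /andP[g1 g2] /andP[y1 y2].
    by apply/andP; split; lra.
  by rewrite asboolT// => i; rewrite /= mxE.
apply: countable_bigcupT_measurable => [|q]; first exact: countableP.
case: ifP => // _.
have -> : f @^-1` B q = \bigcap_(i in [set: 'I_n])
    ((fun x => `|ratr (q.1 i 0) - f x i 0|) @^-1` `]-oo, q.2.+1%:R^-1[).
  apply/seteqP; split=> x /= fx i; first by move=> _; rewrite /= in_itv/=.
  by have := fx i I; rewrite /= in_itv/=.
apply: fin_bigcap_measurable => // i _.
rewrite -[X in measurable X]setTI.
have mg : measurable_fun setT (fun x => `|ratr (q.1 i 0) - f x i 0|).
  by apply: measurableT_comp => //; apply: measurable_funB.
exact: mg.
Qed.

Section closed_graph.
Context (R : realType) (n M : nat) (X : 'M[R]_(n, M)) (r : R).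

Lemma continuous_sum_ord (T : topologicalType) (k : nat) (f : 'I_k -> T -> R) :
  (forall i, continuous (f i)) -> continuous (fun x => \sum_(i < k) f i x).
Proof. by move=> cf; apply: continuous_big => //; exact: add_continuous. Qed.

Lemma continuous_fst_coord (j : 'I_M) :
  continuous (fun p : 'rV[R]_M * 'cV[R]_n => p.1 0 j).
Proof.
move=> p; apply: (@continuous_comp _ _ _ fst (fun v : 'rV[R]_M => v 0 j)).
  exact: cvg_fst.
exact: coord_continuous.
Qed.

Lemma continuous_snd_coord (i : 'I_n) :
  continuous (fun p : 'rV[R]_M * 'cV[R]_n => p.2 i 0).
Proof.
move=> p; apply: (@continuous_comp _ _ _ snd (fun v : 'cV[R]_n => v i 0)).
  exact: cvg_snd.
exact: coord_continuous.
Qed.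

Lemma continuous_fst_l1 :
  continuous (fun p : 'rV[R]_M * 'cV[R]_n => \sum_(j < M) `|p.1^T j 0|).
Proof.
apply: continuous_sum_ord => j p; apply: cvg_norm.
under eq_fun do rewrite mxE; rewrite mxE; exact: continuous_fst_coord.
Qed.

Lemma continuous_residual (i : 'I_n) :
  continuous (fun p : 'rV[R]_M * 'cV[R]_n => (p.2 - X *m p.1^T) i 0).
Proof.
have -> : (fun p : 'rV[R]_M * 'cV[R]_n => (p.2 - X *m p.1^T) i 0) =
    (fun p => p.2 i 0 - \sum_(j < M) X i j * p.1 0 j).
  by apply/funext => p; rewrite !mxE; under eq_bigr do rewrite mxE.
move=> p; apply: cvgB; first exact: continuous_snd_coord.
apply: (@continuous_sum_ord _ _ (fun j (p : 'rV[R]_M * 'cV[R]_n) => X i j * p.1 0 j)) => j q.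
by apply: cvgM; [exact: cvg_cst|exact: continuous_fst_coord].
Qed.

Lemma continuous_correlation (j : 'I_M) :
  continuous (fun p : 'rV[R]_M * 'cV[R]_n =>
    (n%:R^-1 *: (X^T *m (p.2 - X *m p.1^T))) j 0).
Proof.
have -> : (fun p : 'rV[R]_M * 'cV[R]_n =>
    (n%:R^-1 *: (X^T *m (p.2 - X *m p.1^T))) j 0) =
    (fun p => n%:R^-1 * \sum_(i < n) X^T j i * (p.2 - X *m p.1^T) i 0).
  by apply/funext => p; rewrite mxE [in LHS]mxE.
move=> p; apply: cvgM; first exact: cvg_cst.
apply: (@continuous_sum_ord _ _ (fun i (p : 'rV[R]_M * 'cV[R]_n) => X^T j i * (p.2 - X *m p.1^T) i 0)) => i q.
by apply: cvgM; [exact: cvg_cst|exact: continuous_residual].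
Qed.

Lemma continuous_lasso_objective :
  continuous (fun p : 'rV[R]_M * 'cV[R]_n => lasso_objective X r p.2 p.1^T).
Proof.
under eq_fun do rewrite lasso_objectiveE.
move=> p; apply: cvgD.
  apply: cvgM; first exact: cvg_cst.
  apply: (@continuous_sum_ord _ _ (fun i (p : 'rV[R]_M * 'cV[R]_n) => (p.2 - X *m p.1^T) i 0 ^+ 2)) => i q.
  apply: (@continuous_comp _ _ _ (fun p : 'rV[R]_M * 'cV[R]_n => (p.2 - X *m p.1^T) i 0)
    (fun x : R => x ^+ 2)); first exact: continuous_residual.
  exact: exprn_continuous.
by apply: cvgM; [exact: cvg_cst|exact: continuous_fst_l1].
Qed.

Lemma continuous_cst_fst (f : 'rV[R]_M * 'cV[R]_n -> R) (v : 'rV[R]_M) :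
  continuous f -> continuous (fun p : 'rV[R]_M * 'cV[R]_n => f (v, p.2)).
Proof.
move=> cf p; apply: (@continuous_comp _ _ _ (fun p : 'rV[R]_M * 'cV[R]_n => (v, p.2)) f).
  by apply: (@cvg_pair _ _ _ _ (nbhs v) (nbhs p.2)); [exact: cvg_cst|exact: cvg_snd].
exact: cf.
Qed.

(** A strictly better competitor stays strictly better nearby, by joint continuity of the
    objective. *)
Lemma open_not_lasso : open
  (~` [set p : 'rV[R]_M * 'cV[R]_n | lasso_set X r p.2 p.1^T]).
Proof.
rewrite openE => -[rho y] /= notsol.
have [theta lt_theta] : exists theta,
    lasso_objective X r y theta < lasso_objective X r y rho^T.
  apply: contrapT => /forallNP h; apply: notsol; split=> [|theta _]; first exact: I.
  by rewrite leNgt; apply/negP; exact: (h theta).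
have c1 := continuous_lasso_objective.
have c2 := @continuous_cst_fst _ theta^T c1.
pose g p := lasso_objective X r p.2 p.1^T - lasso_objective X r p.2 theta.
have cg : g p @[p --> (rho, y)] --> g (rho, y).
  by apply: cvgB; [exact: c1|have := c2 (rho, y); rewrite /= trmxK].
have : \forall p \near (rho, y), 0 < g p.
  have g0 : 0 < g (rho, y) by rewrite subr_gt0.
  exact: (cvgr_gt _ cg _ g0).
by apply: filterS => p; rewrite subr_gt0 ltNge => /negP lt_p [_ /(_ theta I)].
Qed.

(** The constraint moves with [y], so a better competitor on the boundary of the feasible set may
    become infeasible. It is first moved slightly towards [ls], whose residual correlation is zero;
    this makes it strictly feasible while its l1 norm stays below that of [rho]. *)
Lemma open_not_dantzig : 0 < r -> open
  (~` [set p : 'rV[R]_M * 'cV[R]_n | dantzig_set X r p.2 p.1^T]).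
Proof.
move=> r0; rewrite openE => -[rho y] /= notsol.
have r0' := ltW r0.
have [feas|infeas] := pselect (dantzig_feasible X r y rho^T); last first.
  have [j lt_r] : exists j,
      r < `|(n%:R^-1 *: (X^T *m (y - X *m rho^T))) j 0|.
    apply: contrapT => /forallNP h; apply: infeas; apply/dantzig_feasibleP => // j.
    by rewrite leNgt; apply/negP; exact: h.
  have : \forall p \near (rho, y),
      r < `|(n%:R^-1 *: (X^T *m (p.2 - X *m p.1^T))) j 0|.
    exact: (cvgr_gt _ (cvg_norm (@continuous_correlation j (rho, y))) _ lt_r).
  apply: filterS => p lt_p [+ _]; rewrite dantzig_feasibleP// => /(_ j).
  by rewrite leNgt lt_p.
have [theta [feas1 lt_theta]] : exists theta, dantzig_feasible X r y theta /\
    lp_norm 1 theta < lp_norm 1 rho^T.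
  apply: contrapT => /forallNP h; apply: notsol; split=> [|theta ft]; first exact: feas.
  by rewrite leNgt; apply/negP => lt; exact: (h theta).
have [ls ls0] := normal_equation X y.
rewrite !lp_norm1E in lt_theta.
set a := \sum_j _ in lt_theta; set b := \sum_j _ in lt_theta.
pose l := \sum_j `|ls j 0|.
have l0 : 0 <= l by rewrite sumr_ge0.
have a0 : 0 <= a by rewrite sumr_ge0.
(* The mixing weight must keep [(1 - t) a + t l] below [b]. The [+ 1] in the denominator keeps
   [t < 1] even when [l = 0]. *)
have [t [t0 t1 tl]] : exists t, [/\ 0 < t, t < 1 & t * l < b - a].
  exists ((b - a) / (l + 1 + (b - a))); have den : 0 < l + 1 + (b - a) by lra.
  split; first by rewrite divr_gt0//; lra.
    by rewrite ltr_pdivrMr//; lra.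
  by rewrite mulrAC ltr_pdivrMr//; nra.
pose phi := (1 - t) *: theta + t *: ls.
have phi_l1 : \sum_j `|phi j 0| < b.
  have ta : 0 <= t * a by rewrite mulr_ge0// ltW.
  have lt_b : (1 - t) * a + t * l < b by lra.
  apply: le_lt_trans lt_b.
  rewrite !mulr_sumr -big_split; apply: ler_sum => j _ /=.
  have tN : `|t| = t by rewrite ger0_norm// ltW.
  have t1N : `|1 - t| = 1 - t by rewrite ger0_norm// subr_ge0 ltW.
  have -> : (1 - t) * `|theta j 0| + t * `|ls j 0| =
      `|(1 - t) * theta j 0| + `|t * ls j 0| by rewrite !normrM tN t1N.
  by rewrite !mxE; exact: ler_normD.
(* The [ls] part contributes nothing, so mixing scales the residual correlation by [1 - t < 1]. *)
have phi_lt j : `|(n%:R^-1 *: (X^T *m (y - X *m phi))) j 0| < r.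
  have -> : X^T *m (y - X *m phi) = (1 - t) *: (X^T *m (y - X *m theta)).
    have -> : y - X *m phi = (1 - t) *: (y - X *m theta) + t *: (y - X *m ls).
      rewrite /phi mulmxDr -!scalemxAr !scalerBr addrACA -scalerDl subrK scale1r.
      by rewrite -opprD.
    by rewrite mulmxDr -!scalemxAr ls0 scaler0 addr0.
  rewrite scalerA mulrC -scalerA mxE normrM ger0_norm; last by rewrite subr_ge0 ltW.
  have := feas1; rewrite dantzig_feasibleP// => /(_ j) fj.
  apply: (@le_lt_trans _ _ ((1 - t) * r)).
    by rewrite ler_wpM2l// subr_ge0 ltW.
  by rewrite gtr_pMl// gtrBl.
have n1 : \forall p \near (rho, y),
    forall j, `|(n%:R^-1 *: (X^T *m (p.2 - X *m phi))) j 0| < r.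
  apply: (@filter_forall _ 'I_M (fun j (p : 'rV[R]_M * 'cV[R]_n) =>
    `|(n%:R^-1 *: (X^T *m (p.2 - X *m phi))) j 0| < r) (nbhs (rho, y))) => j.
  have := @continuous_cst_fst _ phi^T (@continuous_correlation j).
  move=> /(_ (rho, y))/cvg_norm; rewrite /= trmxK => c.
  exact: (cvgr_lt _ c _ (phi_lt j)).
have n2 : \forall p \near (rho, y), \sum_j `|phi j 0| < \sum_j `|p.1^T j 0|.
  exact: (cvgr_gt _ (@continuous_fst_l1 (rho, y)) _ phi_l1).
move: n1 n2; apply: filterS2 => p feas_phi lt_phi [_ /(_ phi)].
rewrite !lp_norm1E leNgt lt_phi => h; suff : false by [].
by apply: h; apply/dantzig_feasibleP => // j; exact: ltW.
Qed.

Lemma open_not_solution (e : estimator) : 0 < r -> open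
  (~` [set p : 'rV[R]_M * 'cV[R]_n | solution_set e X r p.2 p.1^T]).
Proof.
by case: e => r0; [exact: open_not_lasso|exact: open_not_dantzig].
Qed.
End closed_graph.

Section sign_cells.
Context (R : realType) (c : R).
Hypothesis c0 : 0 <= c.

Definition cell_sign (t : option bool) : R :=
  match t with None => 0 | Some true => 1 | Some false => -1 end.

(* Compact intervals, increasing with [k] to the set on which the hard
   thresholding has sign [cell_sign t]. *)
Definition cell (t : option bool) (k : nat) : set R :=
  match t with
  | None => `[- c, c]
  | Some true => `[c + k.+1%:R^-1, c + k.+1%:R]
  | Some false => `[- (c + k.+1%:R), - (c + k.+1%:R^-1)]
  end.

Lemma compact_cell t k : compact (cell t k).
Proof. by case: t => [[]|]; exact: segment_compact. Qed.

Lemma cell_signE t k x : cell t k x ->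
  Num.sg (if c < `|x| then x else 0) = cell_sign t.
Proof.
have k0 : 0 < k.+1%:R^-1 :> R by rewrite invr_gt0 ltr0n.
rewrite /cell; move: (_^-1) k0 => a a0.
case: t => [[]|] /=; rewrite in_itv/= => /andP[lx ux].
- have x0 : c < x by rewrite (lt_le_trans _ lx)// ltrDl.
  have x1 := le_lt_trans c0 x0.
  by rewrite gtr0_norm// x0 gtr0_sg.
- have x0 : c < - x by rewrite ltrNr (le_lt_trans ux)// ltrN2 ltrDl.
  have x1 : x < 0 by rewrite -oppr_gt0 (le_lt_trans c0).
  by rewrite ltr0_norm// x0 ltr0_sg.
- by rewrite ltNge ler_norml lx ux/= sgr0.
Qed.

Lemma gt_in_cell x : c < x -> exists k, cell (Some true) k x.
Proof.
move=> cx; have [k kx] := ltr_add_invr cx.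
exists (maxn k (Num.bound (x - c))); rewrite /= in_itv/=; apply/andP; split.
  rewrite (le_trans _ (ltW kx))// lerD2l lef_pV2 ?posrE ?ltr0n// ler_nat ltnS.
  exact: leq_maxl.
rewrite -lerBlDl (@le_trans _ _ (Num.bound (x - c))%:R)//.
  by rewrite ltW// archi_boundP// subr_ge0 ltW.
by rewrite ler_nat (leq_trans (leq_maxr k _)).
Qed.

Lemma cell_cover x : exists t k, cell t k x.
Proof.
have [cx|xc] := ltP c x; first by exists (Some true); exact: gt_in_cell.
have [cx|xc'] := ltP x (- c).
  exists (Some false); have [|k] := @gt_in_cell (- x); first by rewrite ltrNr.
  rewrite /= in_itv/= => /andP[lx ux]; exists k.
  by rewrite /= in_itv/= lerNl ux lerNr lx.
by exists None, 0%N; rewrite /= in_itv/= xc' xc.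
Qed.

(** Coordinate [j] witnesses a sign; the bound [K] on the others is there for compactness. *)
Definition box (M : nat) (j : 'I_M) (t : option bool) (k K : nat) : set 'rV[R]_M :=
  [set v | forall i, (if i == j then cell t k else `[- K%:R, K%:R]%classic) (v ord0 i)].

Lemma compact_box M (j : 'I_M) t k K : compact (box j t k K).
Proof.
apply: (@rV_compact _ _ (fun i => if i == j then cell t k else `[- K%:R, K%:R]%classic)) => i.
by case: ifP => _; [exact: compact_cell|exact: segment_compact].
Qed.

End sign_cells.

(** Failure means that some solution lies in a [box] whose cell sign disagrees with [v] at
    coordinate [j]. There are countably many boxes, and the observations with a solution in a given
    box form a closed set. *)
Lemma measurable_sign_recovery (d : measure_display) (T : measurableType d)
    (R : realType) (n M : nat) (e : estimator) (X : 'M[R]_(n, M)) (r c : R)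
    (Y : T -> 'cV[R]_n) (v : 'cV[R]_M) :
  0 < r -> 0 <= c -> (forall i, measurable_fun setT (fun w => Y w i 0)) ->
  measurable [set w | forall theta_tilde : 'cV[R]_M,
    thresholded_set e X r c (Y w) theta_tilde -> sign_vector theta_tilde = v].
Proof.
move=> r0 c0 mY; rewrite -[X in measurable X]setCK; apply: measurableC.
pose G := [set p : 'rV[R]_M * 'cV[R]_n | solution_set e X r p.2 p.1^T].
pose Q := ('I_M * option bool * nat * nat)%type.
pose C (q : Q) : set 'rV[R]_M := box c q.1.1.1 q.1.1.2 q.1.2 q.2.
pose F (q : Q) := [set y | forall rho, C q rho -> ~ G (rho, y)].
have oF q : open (F q).
  by apply: open_no_witness; [exact: compact_box|exact: open_not_solution].
pose bad (q : Q) := cell_sign R q.1.1.2 != v q.1.1.1 0.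
rewrite [X in measurable X](_ : _ =
    \bigcup_(q : Q) if bad q then Y @^-1` (~` F q) else set0).
  apply: countable_bigcupT_measurable => [|q]; first exact: countableP.
  case: ifP => // _; rewrite -preimage_setC; apply: measurableC.
  exact: measurable_preimage_open.
apply/seteqP; split=> w /=.
  move=> /existsNP[_ /not_implyP[[theta sol <-]]] neqv.
  have /existsNP[j neq] : ~ forall j,
      sign_vector (hard_threshold c theta) j 0 = v j 0.
    by move=> eqv; apply: neqv; apply/matrixP => j k; rewrite ord1; exact: eqv.
  have [t [k tk]] := cell_cover c (theta j 0).
  pose B i := Num.bound `|theta i 0|; pose K := \max_(i < M) B i.
  exists (j, t, k, K) => //=.
  rewrite /bad/= -(cell_signE c0 tk) ifT; last by apply/eqP; move: neq; rewrite !mxE.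
  move=> /(_ theta^T); rewrite /G/= trmxK; apply => //.
  move=> i; rewrite mxE; case: eqP => [-> //|_]; rewrite /= in_itv/= -ler_norml.
  rewrite (le_trans (ltW (archi_boundP (normr_ge0 _))))// ler_nat.
  exact: (leq_bigmax (F := B)).
move=> [q _]; case: ifP => //; rewrite /bad => neq.
move=> /existsNP[rho /not_implyP[Crho /contrapT sol]] h.
have /h/matrixP/(_ q.1.1.1 0) :
    thresholded_set e X r c (Y w) (hard_threshold c rho^T) by exists rho^T.
have := Crho q.1.1.1; rewrite eqxx => /(cell_signE c0).
by rewrite !mxE => -> /eqP; rewrite (negbTE neq).
Qed.

(** * Linear combinations of Gaussian variables *)

Section lebesgue_shift.
Context (R : realType).
Local Notation mu := (@lebesgue_measure R).
Local Open Scope ereal_scope.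

Lemma measurable_shift (a : R) :
  measurable_fun setT ((fun x => x + a)%R : R -> measurableTypeR R).
Proof. exact: measurable_funD. Qed.

(** Uniqueness of Lebesgue measure reduces translation invariance to half-open intervals. *)
Lemma lebesgue_measure_shift (a : R) (B : set R) : measurable B ->
  pushforward mu ((fun x => x + a)%R : R -> measurableTypeR R) B = mu B.
Proof.
move=> mB; have ma := measurable_shift a.
apply/esym/(lebesgue_measure_unique (mu := pushforward mu _)) => //= _ [[b c]] _ <-.
rewrite /pushforward [X in _ = mu X](_ : _ = `]b - a, c - a]%classic)%R.
  rewrite !lebesgue_measure_itv/= !lte_fin ltrD2r -!EFinD.
  by rewrite (_ : (c - a - (b - a) = c - b)%R)//; ring.
by apply/seteqP; split=> x; rewrite /= !in_itv/= ltrBlDr lerBrDr.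
Qed.

Lemma ge0_integral_shift (a : R) (f : R -> \bar R) :
  measurable_fun setT f -> (forall x, 0 <= f x) ->
  \int[mu]_x f (x + a)%R = \int[mu]_x f x.
Proof.
move=> mf f0; have ma := measurable_shift a.
transitivity (\int[pushforward mu ((fun x => x + a)%R : R -> measurableTypeR R)]_x f x).
  by rewrite ge0_integral_pushforward.
by apply: eq_measure_integral => B mB _; exact: lebesgue_measure_shift.
Qed.

End lebesgue_shift.

Section normal_laws.
Context (R : realType).
Local Notation mu := (@lebesgue_measure R).
Local Open Scope ereal_scope.
Implicit Types (m s t a x y z : R) (B : set R).

Lemma normal_probE m s B : measurable B ->
  normal_prob m s B = \int[mu]_x ((\1_B x)%:E * (normal_pdf m s x)%:E).
Proof.
move=> mB; rewrite /normal_prob integral_mkcond; apply: eq_integral => x _.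
by rewrite patchE indicE; case: ifP; rewrite ?mul1e ?mul0e.
Qed.

Import HBNNSimple.

(** Passage to the density, for indicators, then nonnegative simple functions, then monotone
    limits. *)
Lemma ge0_integral_normal_prob m s (f : R -> \bar R) :
  measurable_fun setT f -> (forall x, 0 <= f x) ->
  \int[normal_prob m s]_x f x = \int[mu]_x (f x * (normal_pdf m s x)%:E).
Proof.
move=> mf f0.
have mp : measurable_fun setT (EFin \o normal_pdf m s).
  by apply/measurable_EFinP; exact: measurable_normal_pdf.
have p0 x : 0 <= (normal_pdf m s x)%:E by rewrite lee_fin normal_pdf_ge0.
have indicE' B : measurable B -> \int[normal_prob m s]_x (\1_B x)%:E =
    \int[mu]_x ((\1_B x)%:E * (normal_pdf m s x)%:E).
  by move=> mB; rewrite integral_indic//= setIT normal_probE.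
have nnsfunE (g : {nnsfun R >-> R}) : \int[normal_prob m s]_x (g x)%:E =
    \int[mu]_x ((g x)%:E * (normal_pdf m s x)%:E).
  have mi r : measurable_fun setT (EFin \o (\1_(g @^-1` [set r]) : R -> R)).
    by apply/measurable_EFinP; exact: measurable_indic.
  have mri r : measurable_fun setT
      (fun x => (r * \1_(g @^-1` [set r]) x)%:E).
    by under eq_fun do rewrite EFinM; apply: measurable_funeM; exact: mi.
  under [LHS]eq_integral do rewrite fimfunE -fsumEFin//.
  rewrite [LHS]ge0_integral_fsum//; last first.
    by move=> r x _; rewrite EFinM nnfun_muleindic_ge0.
  under [RHS]eq_integral.
    move=> x xD; rewrite fimfunE -fsumEFin// ge0_mule_fsuml; last first.
      by move=> r; rewrite EFinM nnfun_muleindic_ge0.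
    over.
  rewrite [RHS]ge0_integral_fsum//; last 2 first.
    - by move=> r; apply: emeasurable_funM => //; exact: mri.
    - by move=> r x _; rewrite mule_ge0// EFinM nnfun_muleindic_ge0.
  apply: eq_fsbigr => r _.
  under eq_integral do rewrite EFinM.
  under [RHS]eq_integral do rewrite EFinM -muleA.
  have [r0|r0] := leP 0%R r.
    transitivity (r%:E * \int[normal_prob m s]_x (\1_(g @^-1` [set r]) x)%:E).
      by rewrite ge0_integralZl//; exact: mi.
    rewrite indicE'// -ge0_integralZl//; first by apply: emeasurable_funM => //; exact: mi.
    by move=> x _; rewrite mule_ge0.
  rewrite !integral0_eq// => x _; rewrite preimage_nnfun0// indic0 ?mul0e ?mule0//.
pose f_ := nnsfun_approx measurableT mf.
have mf_ n : measurable_fun setT (EFin \o f_ n).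
  apply/measurable_EFinP; exact: measurable_funPT.
have nd k l x : (k <= l)%N -> (f_ k x <= f_ l x)%R.
  by move=> kl; have /lefP := nd_nnsfun_approx measurableT mf kl; apply.
transitivity (limn (fun n => \int[normal_prob m s]_x (f_ n x)%:E)).
  rewrite -monotone_convergence//=.
  - apply: eq_integral => x _; apply/esym/cvg_lim => //=.
    exact: cvg_nnsfun_approx.
  - by move=> n x _; rewrite lee_fin.
  - by move=> x _ k l kl; rewrite lee_fin nd.
under eq_fun do rewrite nnsfunE.
rewrite -monotone_convergence//=.
- apply: eq_integral => x _; apply/cvg_lim => //=.
  apply: cvgeZr => //; exact: cvg_nnsfun_approx.
- by move=> n; apply: emeasurable_funM => //; exact: mf_.
- by move=> n x _; rewrite mule_ge0// lee_fin.
- move=> x _ k l kl; by rewrite lee_wpmul2r// lee_fin nd.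
Qed.

Local Open Scope ring_scope.

Lemma normal_pdf_expR m s x : s != 0 ->
  normal_pdf m s x = normal_peak s * expR (- (x - m) ^+ 2 / (s ^+ 2 *+ 2)).
Proof. by move=> s0; rewrite normal_pdfE. Qed.

(* Completing the square in [y]. *)
Lemma normal_pdf_convolution a s1 s y z : s1 != 0 -> s != 0 ->
  normal_pdf 0 s1 (z - a * y) * normal_pdf 0 s y =
  normal_pdf 0 (Num.sqrt (s1 ^+ 2 + a ^+ 2 * s ^+ 2)) z *
  normal_pdf (a * s ^+ 2 * z / (s1 ^+ 2 + a ^+ 2 * s ^+ 2))
    (s1 * s / Num.sqrt (s1 ^+ 2 + a ^+ 2 * s ^+ 2)) y.
Proof.
move=> s10 s0; set q := s1 ^+ 2 + _.
have q0 : 0 < q.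
  by rewrite ltr_pwDl ?exprn_even_gt0// mulr_ge0 ?sqr_ge0.
have sq0 : Num.sqrt q != 0 by rewrite gt_eqF// sqrtr_gt0.
have sqq : Num.sqrt q ^+ 2 = q by rewrite sqr_sqrtr// ltW.
have t0 : s1 * s / Num.sqrt q != 0 by rewrite !mulf_neq0 ?invr_eq0.
rewrite !normal_pdf_expR// mulrACA [RHS]mulrACA -!expRD; congr (_ * expR _).
  have p0 x : 0 <= x ^+ 2 * pi *+ 2 by rewrite mulrn_wge0// mulr_ge0 ?sqr_ge0 ?pi_ge0.
  rewrite /normal_peak -!invfM -!sqrtrM//; congr (Num.sqrt _)^-1.
  by rewrite expr_div_n sqq; field; rewrite gt_eqF.
rewrite expr_div_n sqq; have : q != 0 by rewrite gt_eqF.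
by rewrite /q => q1; field; rewrite exprMn q1 s0 s10.
Qed.

(** The law of [Z1 + a Z2] for independent centred Gaussians. After shifting the inner integral by
    [a y] and exchanging the order, completing the square leaves in [y] a Gaussian density of mass
    one. *)
Lemma normal_prob_convolution a s1 s B : s1 != 0 -> s != 0 -> measurable B ->
  (normal_prob 0 s1 \x normal_prob 0 s)%E [set p : R * R | B (p.1 + a * p.2)] =
  normal_prob 0 (Num.sqrt (s1 ^+ 2 + a ^+ 2 * s ^+ 2)) B.
Proof.
move=> s10 s0 mB.
have mf : measurable_fun setT (fun p : R * R => p.1 + a * p.2).
  by apply: measurable_funD => //; exact: measurable_funM.
set E := [set p : R * R | _].
have mE : measurable E by rewrite -[E]setTI; exact: mf.
set s3 := Num.sqrt _; pose m z := a * s ^+ 2 * z / (s1 ^+ 2 + a ^+ 2 * s ^+ 2).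
pose t := s1 * s / s3.
have mpdf m' s' : measurable_fun setT (normal_pdf m' s').
  exact: measurable_normal_pdf.
have m1B : measurable_fun setT (fun z => (\1_B z)%:E : \bar R).
  by apply/measurable_EFinP; exact: measurable_indic.
have inner y : normal_prob 0 s1 (ysection E y) =
    (\int[mu]_z ((\1_B z)%:E * (normal_pdf 0 s1 (z - a * y))%:E))%E.
  rewrite normal_probE; last exact: measurable_ysection.
  rewrite -[RHS](ge0_integral_shift (a * y)); first last.
  - by move=> z; rewrite mule_ge0 ?lee_fin ?normal_pdf_ge0.
  - apply: emeasurable_funM => //; apply/measurable_EFinP.
    by apply: measurableT_comp => //; exact: measurable_funB.
  apply: eq_integral => x _; rewrite addrK !indicE mem_ysection.
  by congr (_%:E * _)%E; congr (_%:R); apply/idP/idP; rewrite !inE.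
pose F (p : R * R) : \bar R := ((\1_B p.2)%:E *
  (normal_pdf 0 s1 (p.2 - a * p.1) * normal_pdf 0 s p.1)%:E)%E.
have F0 p : (0 <= F p)%E.
  by rewrite mule_ge0// lee_fin// mulr_ge0 ?normal_pdf_ge0.
have mF : measurable_fun setT F.
  apply: emeasurable_funM; first exact: (measurableT_comp m1B measurable_snd).
  apply/measurable_EFinP; apply: measurable_funM.
    apply: (measurableT_comp (mpdf 0 s1)); apply: measurable_funB => //.
    exact: measurable_funM.
  exact: (measurableT_comp (mpdf 0 s) measurable_fst).
transitivity (\int[mu]_y \int[mu]_z F (y, z))%E.
  (* The product is rewritten with the second coordinate outermost, so that the sections at fixed
     [y] are translates of [B]. *)
  transitivity ((normal_prob 0 s1 \x^ normal_prob 0 s)%E E).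
    by apply: product_measure_unique => // C D mC mD; exact: product_measure2E.
  rewrite /product_measure2 ge0_integral_normal_prob//; last first.
    exact: measurable_fun_ysection.
  apply: eq_integral => y _; rewrite /= inner -ge0_integralZr//.
  - by apply: eq_integral => z _; rewrite /F/= EFinM muleA.
  - apply: emeasurable_funM => //; apply/measurable_EFinP.
    by apply: measurableT_comp => //; exact: measurable_funB.
  - by move=> z _; rewrite mule_ge0 ?lee_fin ?normal_pdf_ge0.
  - by rewrite lee_fin normal_pdf_ge0.
rewrite fubini_tonelli// normal_probE//; apply: eq_integral => z _.
rewrite /F/=; under eq_integral do rewrite normal_pdf_convolution// EFinM muleA.
rewrite ge0_integralZl//.
- by rewrite integral_normal_pdf mule1.
- by apply/measurable_EFinP; exact: mpdf.
- by move=> y _; rewrite lee_fin normal_pdf_ge0.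
- by rewrite mule_ge0 ?lee_fin ?normal_pdf_ge0.
Qed.

(** For [x >= 0] the cross term in [(x + t)^2] is nonnegative, so the density at [x + t] is at most
    [k] times the density at [x]. Translated by [t], the two tails occupy the disjoint half-lines
    [x > 0] and [x < 0], whose total mass is at most one. *)
Lemma normal_prob_tail s t : s != 0 -> 0 <= t ->
  (normal_prob 0 s [set x | (t < `|x|)%R] <= (expR (- t ^+ 2 / (s ^+ 2 *+ 2)))%:E)%E.
Proof.
move=> s0 t0; set k := expR _.
have s2 : 0 < s ^+ 2 *+ 2 by rewrite pmulrn_rgt0// exprn_even_gt0.
have shift_le x : 0 <= x -> normal_pdf 0 s (x + t) <= k * normal_pdf 0 s x.
  move=> x0; rewrite !normal_pdf_expR// mulrCA ler_wpM2l ?normal_peak_ge0//.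
  rewrite -expRD ler_expR !subr0 -mulrDl ler_wpM2r ?invr_ge0 ?(ltW s2)//.
  rewrite -subr_ge0 (_ : _ - _ = 2 * (x * t)); last by ring.
  by rewrite !mulr_ge0.
have pdfN x : normal_pdf 0 s (- x) = normal_pdf 0 s x.
  by rewrite !normal_pdf_expR// !subr0 sqrrN.
have mp : measurable_fun setT (normal_pdf 0 s) by exact: measurable_normal_pdf.
pose hi c x : \bar R := ((\1_`]c, +oo[%classic x)%:E * (normal_pdf 0 s x)%:E)%E.
pose lo c x : \bar R := ((\1_`]-oo, c[%classic x)%:E * (normal_pdf 0 s x)%:E)%E.
have hi0 c x : (0 <= hi c x)%E by rewrite mule_ge0 ?lee_fin ?normal_pdf_ge0.
have lo0 c x : (0 <= lo c x)%E by rewrite mule_ge0 ?lee_fin ?normal_pdf_ge0.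
have mhi c : measurable_fun setT (hi c).
  by apply: emeasurable_funM; apply/measurable_EFinP => //; exact: measurable_indic.
have mlo c : measurable_fun setT (lo c).
  by apply: emeasurable_funM; apply/measurable_EFinP => //; exact: measurable_indic.
have tailE : [set x | t < `|x|] = `]t, +oo[ `|` `]-oo, - t[.
  by apply/seteqP; split=> x /=; rewrite !in_itv/= andbT ltrNr real_ltr_normr ?num_real// => /orP.
have mtail : measurable [set x : R | t < `|x|].
  by rewrite tailE; exact: measurableU.
have -> : normal_prob 0 s [set x | t < `|x|] =
    (\int[mu]_x (hi t (x + t)%R + lo (- t)%R (x + - t)%R))%E.
  rewrite ge0_integralD//; first last.
  - by apply: measurableT_comp => //; exact: measurable_funD.
  - by apply: measurableT_comp => //; exact: measurable_funD.
  rewrite !ge0_integral_shift// -ge0_integralD//; [|exact: mhi|exact: mlo].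
  rewrite normal_probE//; apply: eq_integral => x _; rewrite /hi /lo -muleDl//; congr (_ * _)%E.
  rewrite -EFinD; congr _%:E; rewrite tailE !indicE in_setU.
  case: (boolP (x \in `]t, +oo[%classic)) => [|_]; last by rewrite add0r.
  rewrite inE/= in_itv/= andbT => tx.
  rewrite (_ : (x \in _) = false) ?addr0//; apply/negP; rewrite inE/= in_itv/=.
  by apply/negP; rewrite -leNgt (le_trans _ (ltW tx))// (le_trans _ t0)// oppr_le0.
have -> : (k%:E = \int[mu]_x (k%:E * (normal_pdf 0 s x)%:E))%E.
  rewrite ge0_integralZl//.
  - by rewrite integral_normal_pdf mule1.
  - exact/measurable_EFinP.
  - by move=> x _; rewrite lee_fin normal_pdf_ge0.
  - by rewrite lee_fin expR_ge0.
apply: ge0_le_integral => //.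
- by move=> x _; rewrite adde_ge0.
- by apply: emeasurable_funD; apply: measurableT_comp => //; exact: measurable_funD.
- by apply: measurable_funeM; exact/measurable_EFinP.
- move=> x _; rewrite /hi /lo !indicE.
  have -> : (x + t \in `]t, +oo[%classic) = (0 < x).
    by apply/idP/idP; rewrite inE/= in_itv/= andbT ltrDr.
  have -> : (x + - t \in `]-oo, - t[%classic) = (x < 0).
    by apply/idP/idP; rewrite inE/= in_itv/= gtrDr.
  case: (ltrgtP x 0) => [x0|x0|->].
  - rewrite mul0e add0e mul1e lee_fin -pdfN opprD opprK -(pdfN x).
    by rewrite shift_le// oppr_ge0 ltW.
  - by rewrite mul0e adde0 mul1e lee_fin shift_le// ltW.
  - by rewrite !mul0e adde0 lee_fin mulr_ge0 ?expR_ge0 ?normal_pdf_ge0.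
Qed.

End normal_laws.

Section gaussian_sums.
Context (d : measure_display) (T : measurableType d) (R : realType).
Context (P : probability T R) (I : finType) (sigma : R) (W : I -> {RV P >-> R}).
Hypothesis sigma0 : 0 < sigma.
Hypothesis hW : iid_normal 0 sigma W.

Let sd (a : I -> R) (l : seq I) : R :=
  Num.sqrt (sigma ^+ 2 * (1 + \sum_(i <- l) a i ^+ 2)).

(** The coefficient of [W i0] is fixed to one so that the variance is positive whatever [a] is, and
    every law in the induction has a density. *)
Let V (a : I -> R) (i0 : I) (l : seq I) (w : T) : R :=
  W i0 w + \sum_(i <- l) a i * W i w.

Let measurable_V a i0 l : measurable_fun setT (V a i0 l).
Proof.
apply: measurable_funD => //; apply: measurable_sum => i.
exact: measurable_funM.
Qed.

Let measurable_event (J : {set I}) (C : I -> set R) :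
  (forall i, measurable (C i)) ->
  measurable (\bigcap_(i in [set` J]) (W i @^-1` C i)).
Proof.
move=> mC; apply: fin_bigcap_measurable => // i _.
by rewrite -[X in measurable X]setTI; exact: measurable_funPT.
Qed.

Let event_setU1 (i : I) (J : {set I}) (B : set R) (C : I -> set R) :
  i \notin J ->
  \bigcap_(j in [set` (i |: J)%SET])
    (W j @^-1` (if j == i then B else C j)) =
  W i @^-1` B `&` \bigcap_(j in [set` J]) (W j @^-1` C j).
Proof.
move=> iJ; apply/seteqP; split=> w /=.
  move=> h; split=> [|j /= jJ].
    by have := h i; rewrite /= in_setU1 eqxx => /(_ isT).
  have := h j; rewrite /= in_setU1 jJ orbT => /(_ isT).
  by case: eqP => // ji; rewrite ji (negbTE iJ) in jJ.
move=> [wB wC] j /=; rewrite in_setU1; case: eqP => [-> //|_ /= jJ].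
exact: wC.
Qed.

Let prod_setU1 (i : I) (J : {set I}) (B : set R) (C : I -> set R) :
  i \notin J ->
  (\prod_(j in (i |: J)%SET) P (W j @^-1` (if j == i then B else C j)) =
   P (W i @^-1` B) * \prod_(j in J) P (W j @^-1` C j))%E.
Proof.
move=> iJ; rewrite big_setU1//= eqxx; congr (_ * _)%E.
by apply: eq_bigr => j jJ; case: eqP => // ji; rewrite ji (negbTE iJ) in jJ.
Qed.

(* The event on the variables outside the sum is carried along so that the
   induction never needs independence of [V] from the next variable as a
   separate fact. *)
Lemma lincomb_law a i0 l : uniq (i0 :: l) ->
  forall (J : {set I}) (C : I -> set R) (B : set R),
  (forall i, measurable (C i)) -> {in J, forall i, i \notin i0 :: l} ->
  measurable B ->
  (P (V a i0 l @^-1` B `&` \bigcap_(i in [set` J]) (W i @^-1` C i)) =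
   normal_prob 0 (sd a l) B * \prod_(i in J) P (W i @^-1` C i))%E.
Proof.
have [indep law] := hW.
have lawE i B : measurable B -> P (W i @^-1` B) = normal_prob 0 sigma B.
  by move=> mB; rewrite -(law i).
elim: l => [_|i l IH /= /and3P[i0il il ul]] J C B mC Jl mB.
  have i0J : i0 \notin J by apply/negP => /Jl; rewrite inE eqxx.
  have -> : V a i0 [::] = W i0.
    by apply/funext => w; rewrite /V big_nil addr0.
  rewrite -event_setU1// indep; last by move=> j; case: ifP.
  rewrite (prod_setU1 _ _ i0J) (lawE i0 B mB).
  by rewrite /sd big_nil addr0 mulr1 sqrtr_sqr gtr0_norm.
have iJ : i \notin J by apply/negP => /Jl; rewrite !inE eqxx orbT.
have sdE : sd a (i :: l) = Num.sqrt (sd a l ^+ 2 + a i ^+ 2 * sigma ^+ 2).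
  rewrite /sd sqr_sqrtr; last first.
    by rewrite mulr_ge0 ?sqr_ge0// addr_ge0// sumr_ge0// => j _; exact: sqr_ge0.
  by rewrite big_cons; congr Num.sqrt; ring.
have sd0 : sd a l != 0.
  rewrite gt_eqF// sqrtr_gt0 mulr_gt0 ?exprn_gt0//.
  by rewrite ltr_pwDl// sumr_ge0// => j _; exact: sqr_ge0.
set D := \bigcap_(j in _) _; set kappa := (\prod_(j in J) _)%E.
have mD : measurable D by exact: measurable_event.
have PD : P D = kappa by exact: indep.
have [r r0 kE] : exists2 r : R, 0 <= r & kappa = r%:E.
  exists (fine (P D)); first by rewrite fine_ge0.
  by rewrite -PD fineK// fin_num_measure.
pose f (w : T) : measurableTypeR R * measurableTypeR R := (V a i0 l w, W i w).
have mf : measurable_fun setT f.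
  have mVW : measurable_fun setT (fun w => (V a i0 l w, W i w)).
    exact: measurable_fun_pair.
  exact: mVW.
pose E := [set p : R * R | B (p.1 + a i * p.2)].
have mE : measurable E.
  rewrite -[E]setTI; suff mg : measurable_fun setT (fun p : R * R => p.1 + a i * p.2) by exact: mg.
  by apply: measurable_funD => //; exact: measurable_funM.
have -> : V a i0 (i :: l) @^-1` B = f @^-1` E.
  apply/funext => w; rewrite /E/= /preimage/=; congr B.
  by rewrite /V big_cons; ring.
have mfE : measurable (f @^-1` E) by rewrite -[X in measurable X]setTI; exact: mf.
(* [r] is the probability of [D]. If it is zero both sides vanish; otherwise one may condition on
   [D]. *)
have [r00|r_neq0] := eqVneq r 0.
  rewrite kE r00 mule0; apply/eqP; rewrite eq_le measure_ge0 andbT.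
  rewrite -[leRHS]/(0%R%:E) -r00 -kE -PD; apply: le_measure; rewrite ?inE//.
  exact: measurableI.
have rV0 : 0 <= r^-1 by rewrite invr_ge0.
(* [m'] is the conditional law of [(V, W i)] given [D]. On rectangles the induction hypothesis, with
   [i] added to [J], identifies it with a product, hence everywhere by uniqueness of product
   measures. *)
have [m' mE'] : exists m' : {measure set (measurableTypeR R * measurableTypeR R) -> \bar R},
    forall A, m' A = (r^-1%:E * P (f @^-1` A `&` D))%E.
  by unshelve eexists (mscale (NngNum rV0) (pushforward (mrestr P mD) f)).
have m'E B1 B2 : measurable B1 -> measurable B2 ->
    (m' (B1 `*` B2) = normal_prob 0 (sd a l) B1 * normal_prob 0 sigma B2)%E.
  move=> mB1 mB2; rewrite mE'.
  have -> : f @^-1` (B1 `*` B2) `&` D = V a i0 l @^-1` B1 `&`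
     \bigcap_(j in [set` (i |: J)%SET]) (W j @^-1` (if j == i then B2 else C j)).
    by rewrite event_setU1// setIA.
  rewrite IH//.
  - rewrite (prod_setU1 _ _ iJ) -/kappa kE (lawE i B2 mB2) muleC -!muleA.
    by rewrite -EFinM mulfV// mule1.
  - by rewrite /= ul (contra _ i0il)// => h; rewrite in_cons h orbT.
  - by move=> j; case: ifP.
  - move=> j; rewrite in_setU1 => /predU1P[->|/Jl].
      rewrite in_cons (negbTE il) orbF; apply: contra i0il => /eqP ->.
      exact: mem_head.
    by rewrite !in_cons !negb_or => /and3P[-> _ ->].
have : (normal_prob 0 (sd a l) \x normal_prob 0 sigma)%E E = m' E.
  apply: product_measure_unique; last exact: mE.
  exact: m'E.
rewrite (normal_prob_convolution _ sd0 (lt0r_neq0 sigma0) mB) -sdE => ->.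
by rewrite mE' kE muleAC -EFinM mulVf// mul1e.
Qed.

Lemma lincomb_tail (c : I -> R) (t : R) :
  0 < \sum_i c i ^+ 2 -> 0 <= t ->
  (P [set w | (t < `|\sum_i c i * W i w|)%R] <=
   (expR (- t ^+ 2 / (sigma ^+ 2 * (\sum_i c i ^+ 2) *+ 2)))%:E)%E.
Proof.
move=> sum0 t0.
(* Dividing by a nonzero coefficient brings the sum to the form [V], with threshold [t / |c i0|]. *)
have [i0 ci0] : exists i0, c i0 != 0.
  apply: contrapT => /forallNP h; move: sum0; rewrite big1 ?ltxx// => i _.
  by have := h i => /negP; rewrite negbK => /eqP ->; rewrite expr0n.
pose a i := c i / c i0; pose l := [seq i <- enum I | i != i0].
have ul : uniq (i0 :: l) by rewrite /= mem_filter eqxx/= filter_uniq ?enum_uniq.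
have sumE (F : I -> R) : \sum_(i <- l) F i = \sum_(i | i != i0) F i.
  by rewrite big_filter big_enum_cond.
have n0 : 0 < `|c i0| by rewrite normr_gt0.
have VE w : \sum_i c i * W i w = c i0 * V a i0 l w.
  rewrite /V sumE (bigD1 i0)//= mulrDr mulr_sumr; congr (_ + _).
  by apply: eq_bigr => i _; rewrite /a; field.
have sdE : sd a l ^+ 2 = sigma ^+ 2 * (\sum_i c i ^+ 2) / c i0 ^+ 2.
  rewrite /sd sqr_sqrtr; last first.
    by rewrite mulr_ge0 ?sqr_ge0// addr_ge0// sumr_ge0// => j _; exact: sqr_ge0.
  rewrite -mulrA; congr (_ * _); rewrite sumE [in RHS](bigD1 i0)//= mulrDl divff ?sqrf_eq0//.
  by rewrite mulr_suml; congr (_ + _); apply: eq_bigr => i _; rewrite /a expr_div_n.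
have sd0 : sd a l != 0.
  by rewrite -sqrf_eq0 sdE !mulf_neq0 ?invr_eq0 ?sqrf_eq0//; exact: lt0r_neq0.
have mtail : measurable [set x : R | t / `|c i0| < `|x|].
  rewrite (_ : [set x | _] = `]t / `|c i0|, +oo[ `|` `]-oo, - (t / `|c i0|)[).
    exact: measurableU.
  apply/seteqP; split=> x /=; rewrite !in_itv/= andbT ltrNr.
    by rewrite real_ltr_normr ?num_real// => /orP.
  by rewrite real_ltr_normr ?num_real// => /orP.
have J0 : {in finset.set0, forall i : I, i \notin i0 :: l}.
  by move=> i; rewrite inE.
have := @lincomb_law a i0 l ul finset.set0 (fun=> setT) _ (fun=> measurableT) J0 mtail.
rewrite big_set0 mule1 (_ : \bigcap_(i in _) _ = setT); last first.
  by rewrite -subTset => w _ i _.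
rewrite setIT => law0.
rewrite [X in P X](_ : _ = V a i0 l @^-1` [set x : R | t / `|c i0| < `|x|]).
  rewrite law0.
  apply: (le_trans (normal_prob_tail sd0 _)); first by rewrite divr_ge0.
  rewrite lee_fin ler_expR sdE le_eqVlt; apply/orP; left; apply/eqP.
  rewrite expr_div_n real_normK ?num_real//.
  by field; rewrite ci0 !gt_eqF.
by apply/seteqP; split=> w /=; rewrite VE normrM ltr_pdivrMr// mulrC.
Qed.
End gaussian_sums.

(** * Sign recovery *)

Lemma union_bound (d : measure_display) (T : measurableType d)
    (R : realType) (P : probability T R) (I : finType) (B : I -> set T) (b : R) :
  (forall j, measurable (B j)) -> (forall j, (P (B j) <= b%:E)%E) ->
  ((1 - #|I|%:R * b)%:E <= P (~` \big[setU/set0]_j B j))%E.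
Proof.
move=> mB Bb.
have mU : measurable (\big[setU/set0]_j B j) by exact: bigsetU_measurable.
have le_b (s : seq I) : (P (\big[setU/set0]_(j <- s) B j) <= ((size s)%:R * b)%:E)%E.
  elim: s => [|j s IH]; first by rewrite big_nil measure0 mul0r.
  rewrite big_cons/= -natr1 mulrDl mul1r addrC EFinD.
  have ms : measurable (\big[setU/set0]_(i <- s) B i) by exact: bigsetU_measurable.
  apply: (le_trans (measureU2 _ (mB j) ms)).
  exact: leeD (Bb j) IH.
rewrite probability_setC// EFinB leeB//.
have := le_b (index_enum I); by rewrite cardT enumT.
Qed.

Theorem theorem2 (R : realType) (d : measure_display) (T : measurableType d)
  (P : probability T R)
  (n M : nat) (hn : (1 <= n)%N) (hM : (2 <= M)%N)
  (sigma : R) (hsigma : 0 < sigma)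
  (X : 'M[R]_(n, M)) (theta_star : 'cV[R]_M)
  (W : 'I_n -> {RV P >-> R}) (hW : iid_normal 0 sigma W)
  (Y : T -> 'cV[R]_n)
  (hY : forall w, Y w = X *m theta_star + \col_(i < n) W i w)
  (A : R) (hA : 2 * Num.sqrt 2 < A)
  (r : R) (hr : r = A * sigma * Num.sqrt (ln M%:R / n%:R))
  (e : estimator) (c0 : R) (hc0 : c0 = cone_constant e R)
  (s : nat) (hs : (1 <= s)%N) (alpha : R) (halpha : 1 < alpha)
  (hdiag : forall j : 'I_M, gram X j j = 1)
  (hcoherence : forall i j : 'I_M, i != j ->
     `|gram X i j| <= 1 / (alpha * (1 + 2 * c0) * s%:R))
  (hsparse : (sparsity theta_star <= s)%N)
  (c2 : R)
  (hc2 : c2 = 3 / 2 * (1 + (1 + c0) ^+ 2 / ((1 + 2 * c0) * (alpha - 1))))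
  (c1 : R) (hc1 : 2 * c2 < c1)
  (hmin : forall j : 'I_M, j \in support_set theta_star ->
     c1 * r < `|theta_star j 0|) :
  ((1 - M%:R `^ (1 - A ^+ 2 / 8))%:E <=
   P [set w | forall theta_tilde : 'cV[R]_M,
        thresholded_set e X r (c2 * r) (Y w) theta_tilde ->
        sign_vector theta_tilde = sign_vector theta_star])%E.
Proof.

have M0 : 0 < M%:R :> R by rewrite ltr0n (leq_trans _ hM).
have n0 : 0 < n%:R :> R by rewrite ltr0n.
have lnM : 0 < ln M%:R :> R by rewrite ln_gt0// ltr1n.
have A0 : 0 < A by rewrite (lt_trans _ hA)// mulr_gt0// sqrtr_gt0.
have r0 : 0 < r by rewrite hr !mulr_gt0// sqrtr_gt0 divr_gt0.
have r2 : r ^+ 2 = A ^+ 2 * sigma ^+ 2 * (ln M%:R / n%:R).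
  by rewrite hr !exprMn sqr_sqrtr// ltW// divr_gt0.
have c01 : 1 <= c0 by rewrite hc0; case: (e) => /=; rewrite ?ler1n.
have c20 : 0 < c2.
  rewrite hc2 mulr_gt0// ltr_pwDl// divr_ge0 ?sqr_ge0// mulr_ge0//; lra.
pose c (j : 'I_M) (i : 'I_n) : R := n%:R^-1 * X i j.
pose B (j : 'I_M) := [set w | r / 2 < `|\sum_i c j i * W i w|].
have mB j : measurable (B j).
  have mS : measurable_fun setT (fun w => `|\sum_i c j i * W i w|).
    apply: measurableT_comp => //; apply: measurable_sum => i.
    exact: measurable_funM.
  rewrite (_ : B j = (fun w => `|\sum_i c j i * W i w|) @^-1` `]r / 2, +oo[).
    by rewrite -[X in measurable X]setTI; exact: mS.
  by apply/seteqP; split=> w; rewrite /B /= in_itv/= andbT.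
(* The unit diagonal of the Gram matrix gives each noise coordinate variance [sigma^2 / n]. *)
have sumc j : \sum_i c j i ^+ 2 = n%:R^-1.
  transitivity (n%:R^-1 * gram X j j); last by rewrite hdiag mulr1.
  rewrite !mxE !mulr_sumr; apply: eq_bigr => i _.
  by rewrite !mxE /c; ring.
(* The exponent is [(r / 2)^2 / (2 sigma^2 / n) = A^2 ln M / 8]; the union over [M] coordinates then
   costs a factor [M]. *)
have PB j : (P (B j) <= (M%:R `^ (- A ^+ 2 / 8))%:E)%E.
  have r20 : 0 <= r / 2 by rewrite divr_ge0// ltW.
  have S0 : 0 < \sum_i c j i ^+ 2 by rewrite sumc invr_gt0.
  apply: (le_trans (lincomb_tail hsigma hW S0 r20)).
  rewrite lee_fin sumc /powR gt_eqF// ler_expR le_eqVlt; apply/orP; left; apply/eqP.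
  by rewrite expr_div_n r2; field; rewrite !gt_eqF.
have mE : measurable [set w | forall theta_tilde : 'cV[R]_M,
    thresholded_set e X r (c2 * r) (Y w) theta_tilde ->
    sign_vector theta_tilde = sign_vector theta_star].
  apply: measurable_sign_recovery => //; first by rewrite mulr_ge0// ltW.
  move=> i; rewrite (_ : (fun w => Y w i 0) = (fun w => (X *m theta_star) i 0 + W i w)).
    exact: measurable_funD.
  by apply/funext => w; rewrite hY !mxE.
have := union_bound mB PB; rewrite card_ord.
have -> : M%:R * M%:R `^ (- A ^+ 2 / 8) = M%:R `^ (1 - A ^+ 2 / 8) :> R.
  by rewrite mulNr powRD ?(lt0r_neq0 M0) ?implybT// powRr1// ltW.
move=> /le_trans; apply; apply: le_measure; rewrite ?inE//.
  by apply: measurableC; exact: bigsetU_measurable.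
move=> w goodw _ [theta sol <-].
have noise j : `|(n%:R^-1 *: (X^T *m \col_i W i w)) j 0| <= r / 2.
  have -> : (n%:R^-1 *: (X^T *m \col_i W i w)) j 0 = \sum_i c j i * W i w.
    by rewrite !mxE mulr_sumr; apply: eq_bigr => i _; rewrite !mxE mulrA.
  rewrite leNgt; apply/negP => lt_r; apply: goodw.
  by rewrite (bigD1 j)//=; left.
rewrite hY in sol.
have cone := solution_cone r0 noise sol.
have err := gram_error_le r0 noise hdiag sol.
have b0 : 0 <= 3 / 2 * r by rewrite mulr_ge0// ltW.
rewrite -hc0 in cone.
(* With [b = 3 r / 2] the bound is exactly [c2 * r], the threshold. *)
have sup := sup_norm_of_coherence hs hsparse halpha c01 b0 hdiag hcoherence err cone.
apply: (sign_threshold_eq _ _ _ hmin); first by rewrite mulr_ge0// ltW.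
  by rewrite mulrA ler_wpM2r// ltW.
by move=> j; rewrite (le_trans (sup j))// hc2 mulrAC.
Qed.
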